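(* Let $m>0$, $\mu>0$, $\varepsilon>0$. For each class $\mathcal{C}$ below let $N$ be the indicated integer, and assume $1+\sqrt2\le(1-2\varepsilon)\log(N-1)$. If there is a non-adaptive procedure with precision budget $m$ satisfying $\mathbb{P}_S(\hat S\ne S)\le\varepsilon$ for all $S\in\mathcal{C}$, then necessarily: 1. ($s$-sets, $N=\binom ns$) $\mu \geq \sqrt{(1- 2\varepsilon) \frac{n}{2sm} \log \left(\binom{n}{s} -1\right)}$; 2. ($s$-intervals, $n/s$ an integer, $N=n/s$) $\mu \geq \sqrt{(1- 2\varepsilon) \frac{n}{2sm} \log \left(\frac{n}{s} -1\right)}$; 3. (unions of $k$ disjoint $s$-intervals, $n/s$ an integer, $N=\binom{n/s}{k}$) $\mu \geq \sqrt{(1- 2\varepsilon) \frac{n}{2ksm} \log \left(\binom{n/s}{k} -1\right)}$; 4. (unions of $k$ disjoint $s$-stars in the complete graph on $p$ vertices, $n=p(p-1)/2$, $k(s+1)\le p$, $N=\binom{p}{k(s+1)}$) $\mu \geq \sqrt{(1- 2\varepsilon) \frac{n}{2ksm} \log \left(\binom{p}{k(s+1)} -1\right)}$; 5. ($s$-submatrices of an $n_1\times n_2$ matrix, $n=n_1n_2$, $\sqrt s$ an integer, $N=\binom{n_1}{\sqrt s}\binom{n_2}{\sqrt s}$) $\mu \geq \sqrt{(1- 2\varepsilon) \frac{n}{2sm} \log \left(\binom{n_1}{\sqrt{s}} \binom{n_2}{\sqrt{s}} -1\right)}$.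
   Context: Classes of subsets of $\{1,\dots,n\}$ ($s,k\ge1$ integers). $s$-sets: all subsets of cardinality $s$. $s$-intervals: sets $\{i,\dots,i+s-1\}$, $1\le i\le n-s+1$. Unions of $k$ disjoint $s$-intervals: unions of $k$ pairwise disjoint $s$-intervals. Stars: coordinates are identified with the edges of the complete graph on $p$ vertices; an $s$-star is a set of $s$ edges sharing a common vertex, and disjoint means no common edge. $s$-submatrices: coordinates are identified with $\{1,\dots,n_1\}\times\{1,\dots,n_2\}$; an $s$-submatrix is a set $S_1\times S_2$ with $|S_1|\cdot|S_2|=s$. Non-adaptive sensing model. For an unknown $S\in\mathcal{C}$, the signal $\boldsymbol{x}\in\mathbb{R}^n$ has $x_i=\mu$ if $i\in S$ and $x_i=0$ otherwise. Measurements are $Y_j=x_{A_j}+\Gamma_j^{-1/2}W_j$, $j=1,2,\dots$, with $W_j$ i.i.d. $\mathcal{N}(0,1)$, $A_j\in\{1,\dots,n\}$, $\Gamma_j>0$, where $\{A_j,\Gamma_j\}_j$ are chosen before any observation is collected (independently of the noise and of $S$), subject to the precision budget $\mathbb{E}\big(\sum_j\Gamma_j\big)\le m$. An estimator $\hat S$ is a function of $\{Y_j,A_j,\Gamma_j\}_j$. A non-adaptive procedure consists of such a choice and an estimator. $\mathbb{P}_S$ is the probability when the support is $S$. *)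

(* Defs.v *)
From HB Require Import structures.
From mathcomp Require Import all_boot all_order all_algebra.
From mathcomp Require Import all_classical all_reals all_analysis.

Set Implicit Arguments.
Unset Strict Implicit.
Unset Printing Implicit Defensive.

Import Order.TTheory GRing.Theory Num.Theory.

Local Open Scope classical_set_scope.
Local Open Scope ring_scope.

(* Coordinates form an arbitrary finType T, so that n = #|T|: T is 'I_n for
   sets and intervals, the edges of a complete graph for stars, and
   'I_n1 * 'I_n2 for submatrices. A class of supports is a {set {set T}}. *)

Definition s_sets (n s : nat) : {set {set 'I_n}} :=
  [set S : {set 'I_n} | #|S| == s]%SET.

(* Coordinates are numbered from 0, so an s-interval is {i, ..., i + s - 1}
   with 0 <= i <= n - s. *)
Definition interval_from (n s i : nat) : {set 'I_n} :=
  [set j : 'I_n | (i <= j < i + s)%N]%SET.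

Definition s_intervals (n s : nat) : {set {set 'I_n}} :=
  [set interval_from n s i | i : 'I_n.+1 & (i + s <= n)%N]%SET.

Definition disjoint_unions (T : finType) (k : nat) (C : {set {set T}}) :
    {set {set T}} :=
  [set finset.cover F | F : {set {set T}} &
     [&& #|F| == k, F \subset C & finset.trivIset F]]%SET.

Definition edge (p : nat) := {e : {set 'I_p} | #|e| == 2%N}.

Definition s_stars (p s : nat) : {set {set edge p}} :=
  [set F : {set edge p} |
     (#|F| == s) && [exists v : 'I_p, forall e in F, v \in val e]]%SET.

Definition s_submatrices (n1 n2 s : nat) : {set {set 'I_n1 * 'I_n2}} :=
  [set S : {set 'I_n1 * 'I_n2} |
     [exists S1 : {set 'I_n1}, exists S2 : {set 'I_n2},
        (S == finset.setX S1 S2) && (#|S1| * #|S2| == s)%N]]%SET.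

Section Independence.
Context {d : measure_display} {Omega : measurableType d} {R : realType}.
Variable P : probability Omega R.

Definition mutually_independent (X : nat -> {RV P >-> R}) : Prop :=
  forall (J : seq nat) (B : nat -> set R), uniq J ->
    (forall j, measurable (B j)) ->
    P (\bigcap_(j in [set` J]) (X j @^-1` B j)) =
    (\prod_(j <- J) P (X j @^-1` B j))%E.

Definition independent_systems (F G : set (set Omega)) : Prop :=
  forall E E', F E -> G E' -> P (E `&` E') = (P E * P E')%E.

End Independence.

Section Sensing.
Context {R : realType} {T : finType}.

Definition signal (mu : R) (S : {set T}) (i : T) : R :=
  if i \in S then mu else 0.

(* The triples (Y_j, A_j, Gamma_j) for all j, i.e. the data available to an
   estimator. *)
Definition data := nat -> R * T * R.

(* The product sigma-algebra on [data], T being discrete. *)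
Definition data_measurable : set (set data) :=
  <<s \bigcup_j
      (preimage_set_system setT (fun u : data => (u j).1.1) measurable `|`
       preimage_set_system setT (fun u : data => (u j).1.2) setT `|`
       preimage_set_system setT (fun u : data => (u j).2) measurable) >>.

Definition measurable_estimator (Shat : data -> {set T}) : Prop :=
  forall S : {set T}, data_measurable [set u | Shat u = S].

Context {d : measure_display} {Omega : measurableType d}.
Variable P : probability Omega R.

Section Procedure.
Variables (A : nat -> Omega -> T) (Gamma W : nat -> {RV P >-> R}).

Definition sigma_design : set (set Omega) :=
  <<s \bigcup_j (preimage_set_system setT (A j) setT `|`
                 preimage_set_system setT (Gamma j) measurable) >>.

Definition sigma_noise : set (set Omega) :=
  <<s \bigcup_j preimage_set_system setT (W j) measurable >>.

(* Neither A nor Gamma is allowed to depend on the support S: this is what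
   independence of the design from S means. *)
Record nonadaptive_design (m : R) : Prop := NonadaptiveDesign {
  measurable_location : forall j i, measurable [set w | A j w = i];
  precision_gt0 : forall j w, 0 < Gamma j w;
  noise_independent : mutually_independent W;
  noise_standard_normal : forall j (B : set R), measurable B ->
    distribution P (W j) B = normal_prob 0 1 B;
  design_independent_noise : independent_systems P sigma_design sigma_noise;
  precision_budget :
    (\int[P]_w (\sum_(0 <= j <oo) (Gamma j w)%:E) <= m%:E)%E }.

Definition observation (mu : R) (S : {set T}) (w : Omega) : data :=
  fun j => (signal mu S (A j w) + (Num.sqrt (Gamma j w))^-1 * W j w,
            A j w, Gamma j w).

End Procedure.

End Sensing.

(* A single probability space carries the design and the noise for all supports
   S, and the law P_S of the data is the law of [observation A Gamma W mu S].
   Only that law matters, so sharing the space loses no generality. *)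
Definition recoverable (R : realType) (T : finType) (C : {set {set T}})
    (m mu eps : R) : Prop :=
  exists (d : measure_display) (Omega : measurableType d)
         (P : probability Omega R) (A : nat -> Omega -> T)
         (Gamma W : nat -> {RV P >-> R}) (Shat : data -> {set T}),
    [/\ nonadaptive_design A Gamma W m,
        measurable_estimator Shat &
        forall S : {set T}, S \in C ->
          (P [set w | Shat (observation A Gamma W mu S w) <> S] <= eps%:E)%E].

(* Main.v *)
(* A Fano-type argument in which the Kullback-Leibler divergence is replaced by
   a change of measure. Conditionally on the design, support S shifts the
   normalised noise W_j by c_j = mu sqrt(Gamma_j) 1[A_j in S]. With
   Z = exp(- sum c_j W_j - sum c_j^2 / 2) one has E[1_B(data under S) Z] =
   P_null(B) and E[Z] = E[Z'] = 1, where Z' is Z with -c for c, so the pointwise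
   bound t 1_B + 2 <= Z' + sum c_j^2 + Z + (e^t - 1) Z 1_B gives
     t P_S(B) <= mu^2 E(sum_j Gamma_j 1[A_j in S]) + (e^t - 1) P_null(B).
   Take B = {Shat = S} and t = ln(N - 1), and sum over a family F of at least N
   supports of size q in which every coordinate is equally frequent: the null
   probabilities sum to at most 1 and the precisions to at most |F| q m / n.
   Hence mu^2 q m / n >= (1 - eps) t - 1 >= (1 - 2 eps) t / 2, as t >= 2. *)

Require Import Defs.
From HB Require Import structures.
From mathcomp Require Import all_boot all_order all_algebra.
From mathcomp Require Import all_classical all_reals all_analysis.
From mathcomp Require Import perm measurable_realfun ring lra.

Set Implicit Arguments.
Unset Strict Implicit.
Unset Printing Implicit Defensive.

Import Order.TTheory GRing.Theory Num.Theory.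

(** * Coordinate frequencies in the classes of supports *)

Section frequency.
Variable T : finType.
Implicit Types (F C : {set {set T}}) (h : T -> T).

Definition set_invariant h F := forall S, S \in F -> h @: S \in F.

(** An injection preserving [F] and moving [i] to [j] embeds the members of [F] containing [i] into
    those containing [j]. So all coordinates are equally frequent, and counting the pairs of a
    member and one of its elements in two ways gives the value. *)
Lemma frequency_symmetric F q :
  (forall S, S \in F -> #|S| = q) ->
  (forall i j, exists h, [/\ injective h, h i = j & set_invariant h F]) ->
  forall i, #|[set S in F | i \in S]%SET| * #|T| = #|F| * q.
Proof.
move=> Fq sym i.
have freq_le j k : #|[set S in F | j \in S]%SET| <= #|[set S in F | k \in S]%SET|.
  have [h [hI <- hF]] := sym j k.
  rewrite -(card_imset _ (imset_inj hI)).
  apply/subset_leq_card/fintype.subsetP => _ /imsetP[S + ->].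
  by rewrite !inE => /andP[SF jS]; rewrite hF// imset_f.
have -> : #|[set S in F | i \in S]%SET| * #|T| = \sum_j #|[set S in F | j \in S]%SET|.
  rewrite mulnC -sum_nat_const; apply: eq_bigr => j _.
  by apply/eqP; rewrite eqn_leq !freq_le.
under eq_bigr do rewrite cardsE -sum1_card big_mkcondr/=.
rewrite exchange_big/= -sum_nat_const; apply: eq_bigr => S SF.
by rewrite -(Fq S SF) -sum1_card [RHS]big_mkcond.
Qed.

Lemma disjoint_unions_invariant h C k : injective h -> set_invariant h C ->
  set_invariant h (disjoint_unions k C).
Proof.
move=> hI hC _ /imsetP[G + ->]; rewrite inE => /and3P[/eqP Gk GC Gt].
have hII := imset_inj hI.
apply/imsetP; exists ((fun S : {set T} => h @: S) @: G).
  rewrite inE card_imset// Gk eqxx/=; apply/andP; split.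
    apply/fintype.subsetP => _ /imsetP[S SG ->].
    by apply: hC; exact: (fintype.subsetP GC).
  apply/finset.trivIsetP => _ _ /imsetP[S SG ->] /imsetP[S' SG' ->] SS'.
  rewrite imset_disjoint//.
  by apply: (finset.trivIsetP Gt) => //; apply: contraNneq SS' => ->.
apply/finset.setP => x; apply/imsetP/finset.bigcupP.
  by move=> [y /finset.bigcupP[S SG yS] ->]; exists (h @: S); exact: imset_f.
move=> [_ /imsetP[S SG ->] /imsetP[y yS ->]]; exists y => //.
by apply/finset.bigcupP; exists S.
Qed.

Lemma card_disjoint_union C k s S : (forall S', S' \in C -> #|S'| = s) ->
  S \in disjoint_unions k C -> #|S| = k * s.
Proof.
move=> Cs /imsetP[G + ->]; rewrite inE => /and3P[/eqP Gk GC /eqP <-].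
rewrite (eq_bigr (fun=> s)); first by rewrite sum_nat_const Gk.
by move=> S' S'G; apply: Cs; exact: (fintype.subsetP GC).
Qed.

End frequency.

Lemma s_sets_frequency n s i :
  #|[set S in s_sets n s | i \in S]%SET| * #|'I_n| = #|s_sets n s| * s.
Proof.
move: i; apply: frequency_symmetric => [S|i j]; first by rewrite inE => /eqP.
exists (tperm i j); split; [exact: perm_inj|exact: tpermL|].
by move=> S; rewrite !inE card_imset//; exact: perm_inj.
Qed.

Lemma card_s_sets n s : #|s_sets n s| = 'C(n, s).
Proof. by rewrite card_draws card_ord. Qed.

(** * Aligned blocks, for intervals and their unions *)

Section blocks.
Variables (n s : nat).
Hypotheses (s_gt0 : 0 < s) (s_dvd : s %| n).

(** Only intervals starting at a multiple of [s] are kept: they partition the coordinates, whereas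
    among all [s]-intervals the coordinates near the ends may be less frequent. *)
Definition block (l : 'I_(n %/ s)) : {set 'I_n} := interval_from n s (l * s).

Definition block_union (b : {set 'I_(n %/ s)}) : {set 'I_n} :=
  finset.cover (block @: b).

Lemma block_index_proof (i : 'I_n) : i %/ s < n %/ s.
Proof. by rewrite ltn_divRL// (leq_ltn_trans (leq_divM _ _)). Qed.

Definition block_index i := Ordinal (block_index_proof i).

Lemma block_base_proof (l : 'I_(n %/ s)) : l * s < n.
Proof. by rewrite -ltn_divRL. Qed.

Lemma in_block i l : (i \in block l) = (block_index i == l).
Proof.
rewrite inE -val_eqE /= eqn_leq leq_divRL// andbC; congr (_ && _).
by rewrite -[RHS]ltnS ltn_divLR// mulSn addnC.
Qed.

Lemma block_indexK l : block_index (Ordinal (block_base_proof l)) = l.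
Proof. by apply: val_inj; rewrite /= mulnK. Qed.

Lemma block_inj : injective block.
Proof.
move=> l l' /finset.setP/(_ (Ordinal (block_base_proof l))).
by rewrite !in_block block_indexK eqxx => /esym/eqP.
Qed.

Lemma in_block_union i b : (i \in block_union b) = (block_index i \in b).
Proof.
apply/finset.bigcupP/idP.
  by move=> [_ /imsetP[l lb ->]]; rewrite in_block => /eqP ->.
by move=> ib; exists (block (block_index i)); rewrite ?imset_f// in_block.
Qed.

Lemma block_union_inj : injective block_union.
Proof.
move=> b b' /finset.setP bb'; apply/finset.setP => l.
by have := bb' (Ordinal (block_base_proof l)); rewrite !in_block_union block_indexK.
Qed.

Definition block_unions k : {set {set 'I_n}} := block_union @: s_sets (n %/ s) k.

Lemma card_block_unions k : #|block_unions k| = 'C(n %/ s, k).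
Proof. by rewrite (card_imset _ block_union_inj) card_s_sets. Qed.

(** A coordinate lies in a union of blocks exactly when its block is selected, so the count reduces
    to that of [k]-sets among [n %/ s] points; divisibility turns the number of blocks times [s]
    into [n]. *)
Lemma block_unions_frequency k i :
  #|[set S in block_unions k | i \in S]%SET| * #|'I_n| = #|block_unions k| * (k * s).
Proof.
rewrite (_ : [set S in _ | _]%SET =
    block_union @: [set b in s_sets (n %/ s) k | block_index i \in b]%SET).
  rewrite !(card_imset _ block_union_inj) mulnA.
  by rewrite -(s_sets_frequency k (block_index i)) -mulnA !card_ord divnK.
apply/finset.setP => S; rewrite inE; apply/andP/imsetP.
  move=> [/imsetP[b bk ->]]; rewrite in_block_union => ib; exists b => //.
  by rewrite inE bk.
by move=> [b + ->]; rewrite inE in_block_union => /andP[bk ib]; rewrite imset_f.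
Qed.

Lemma block_unions_sub k : block_unions k \subset disjoint_unions k (s_intervals n s).
Proof.
apply/fintype.subsetP => _ /imsetP[b bk ->]; apply/imset_f.
move: bk; rewrite !inE card_imset; last exact: block_inj.
move=> ->/=; apply/andP; split.
  apply/fintype.subsetP => _ /imsetP[l _ ->].
  have ln : l * s + s <= n by rewrite addnC -mulSn -leq_divRL.
  apply/imsetP; exists (Ordinal (ltnW (block_base_proof l) : l * s < n.+1)).
    by rewrite inE.
  by [].
apply/finset.trivIsetP => _ _ /imsetP[l _ ->] /imsetP[l' _ ->] ll'.
rewrite -setI_eq0; apply/eqP/finset.setP => i.
rewrite finset.in_setI !in_block finset.in_set0; apply/negP => /andP[/eqP il /eqP il'].
by move/eqP: ll'; rewrite -il il'.
Qed.

End blocks.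

(** Lets the block unions with [k = 1] serve for the class of single intervals. *)
Lemma disjoint_unions1_sub (T : finType) (C : {set {set T}}) :
  disjoint_unions 1 C \subset C.
Proof.
apply/fintype.subsetP => _ /imsetP[G + ->]; rewrite inE => /and3P[/cards1P[S ->] SC _].
by rewrite finset.cover1 -finset.sub1set.
Qed.

(** * Stars in the complete graph *)

Section stars.
Variable p : nat.

Lemma card_edge : #|{: edge p}| = (p * (p - 1)) %/ 2.
Proof. by rewrite card_sig -cardsE card_draws card_ord bin2 divn2 subn1. Qed.

Lemma edge_map_proof (f : {perm 'I_p}) (e : edge p) : #|f @: val e| == 2.
Proof. by rewrite card_imset ?(valP e)//; exact: perm_inj. Qed.

Definition edge_map (f : {perm 'I_p}) (e : edge p) : edge p :=
  Sub (f @: val e) (edge_map_proof f e).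

Lemma edge_map_inj f : injective (edge_map f).
Proof. by move=> e e' /(congr1 val)/= /(imset_inj (@perm_inj _ f))/val_inj. Qed.

Lemma edge_map_transitive e e' : exists f, edge_map f e = e'.
Proof.
have [a [b [ab eE]]] := cards2P _ (valP e).
have [a' [b' [ab' eE']]] := cards2P _ (valP e').
(* The first transposition takes [a] to [a']. The second takes the image of [b] to [b'] and fixes
   [a'], since both points that it exchanges differ from [a']. *)
pose f := (tperm a a' * tperm (tperm a a' b) b')%g.
have b1 : tperm a a' b != a'.
  by rewrite -[X in _ != X](tpermL a a') (inj_eq perm_inj) eq_sym.
have fa : f a = a' by rewrite permM tpermL tpermD// eq_sym.
have fb : f b = b' by rewrite permM tpermL.
by exists f; apply: val_inj; rewrite /= eE eE' imsetU1 imset_set1 fa fb.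
Qed.

Lemma s_stars_invariant s f : set_invariant (edge_map f) (s_stars p s).
Proof.
move=> S; rewrite !inE => /andP[Ss /existsP[v /forall_inP vS]].
rewrite card_imset ?Ss; last exact: edge_map_inj.
apply/existsP; exists (f v); apply/forall_inP => _ /imsetP[e eS ->].
by apply: imset_f; exact: vS.
Qed.

Lemma star_unions_frequency s k e :
  #|[set S in disjoint_unions k (s_stars p s) | e \in S]%SET| * #|{: edge p}| =
  #|disjoint_unions k (s_stars p s)| * (k * s).
Proof.
move: e; apply: frequency_symmetric => [S|e e'].
  by apply: card_disjoint_union => S'; rewrite inE => /andP[/eqP].
have [f fe] := edge_map_transitive e e'.
exists (edge_map f); split => //; first exact: edge_map_inj.
by apply: disjoint_unions_invariant; [exact: edge_map_inj|exact: s_stars_invariant].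
Qed.

Definition star_vertices (S : {set edge p}) : {set 'I_p} := \bigcup_(e in S) val e.

(** A vertex set of this size splits into [k] groups of [s + 1] vertices, each spanned by a star
    with [s] edges. This bounds the number of unions of stars from below by the number of such
    vertex sets. *)
Lemma star_vertices_surj s k (V : {set 'I_p}) : 0 < s -> #|V| = k * (s + 1) ->
  exists2 S, S \in disjoint_unions k (s_stars p s) & star_vertices S = V.
Proof.
move=> s0 Vk.
(* V is indexed by pairs (i, l) with l <= s; the star i joins (i, 0) to (i, l)
   for 1 <= l <= s. *)
have cV : #|{: 'I_k * 'I_s.+1}| = #|V| by rewrite card_prod !card_ord Vk addn1.
pose f x := enum_val (cast_ord cV (enum_rank x)).
have fI : injective f.
  by move=> x y /enum_val_inj/cast_ord_inj/enum_rank_inj.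
have fV : f @: [set: _] = V.
  apply/eqP; rewrite eqEcard card_imset// cardsT cV leqnn andbT.
  by apply/fintype.subsetP => _ /imsetP[x _ ->]; exact: enum_valP.
have mkP i (l : 'I_s) : #|[set f (i, ord0); f (i, lift ord0 l)]%SET| == 2.
  by rewrite cards2 (inj_eq fI) xpair_eqE eqxx.
pose mk i l : edge p := exist (fun e : {set 'I_p} => #|e| == 2) _ (mkP i l).
pose star i := [set mk i l | l in 'I_s]%SET.
(* The centre of star [i] belongs to the common edge, and the groups of vertices are disjoint. Hence
   different indices give edge-disjoint stars. *)
have centerE i l i' l' : mk i l = mk i' l' -> i = i'.
  move=> /(congr1 val)/= /finset.setP/(_ (f (i, ord0))).
  by rewrite !inE eqxx/= => /esym/orP[]/eqP/fI[].
have mkI i : injective (mk i).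
  move=> l l' /(congr1 val)/= /finset.setP/(_ (f (i, lift ord0 l))).
  rewrite !inE eqxx orbT => /esym/orP[]/eqP/fI/(congr1 snd)/=; last exact: lift_inj.
  by move/eqP; rewrite eq_sym (negbTE (neq_lift _ _)).
have starI : injective star.
  move=> i i' /finset.setP/(_ (mk i (Ordinal s0))).
  rewrite imset_f// => /esym/imsetP[l _]; exact: centerE.
exists (finset.cover [set star i | i in 'I_k]%SET).
  apply/imset_f; rewrite inE card_imset// card_ord eqxx/=; apply/andP; split.
    apply/fintype.subsetP => _ /imsetP[i _ ->].
    rewrite inE card_imset// card_ord eqxx/=.
    apply/existsP; exists (f (i, ord0)); apply/forall_inP => _ /imsetP[l _ ->].
    by rewrite !inE eqxx.
  apply/finset.trivIsetP => _ _ /imsetP[i _ ->] /imsetP[i' _ ->] ii'.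
  rewrite -setI_eq0; apply/eqP/finset.setP => e; rewrite !inE; apply/negP.
  move=> /andP[/imsetP[l _ ->] /imsetP[l' _] /centerE ie].
  by move/eqP: ii'; rewrite ie.
rewrite -fV; apply/finset.setP => v; apply/finset.bigcupP/imsetP.
  move=> [_ /finset.bigcupP[_ /imsetP[i _ ->] /imsetP[l _ ->]]].
  rewrite !inE => /orP[]/eqP ->; by eexists.
move=> [[i l] _ ->].
(* A leaf lies on its own edge; the centre lies on the first edge, which exists because [s] is
   positive. *)
have [l' vl] : exists l', f (i, l) \in val (mk i l').
  case: (unliftP ord0 l) => [l' ->|->]; last by exists (Ordinal s0); rewrite !inE eqxx.
  by exists l'; rewrite !inE eqxx orbT.
exists (mk i l') => //; apply/finset.bigcupP; exists (star i); exact: imset_f.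
Qed.

Lemma card_star_unions s k : 0 < s ->
  'C(p, k * (s + 1)) <= #|disjoint_unions k (s_stars p s)|.
Proof.
move=> s0; rewrite -card_s_sets.
apply: leq_trans (leq_imset_card star_vertices _).
apply/subset_leq_card/fintype.subsetP => V; rewrite inE => /eqP Vk.
by have [S SF <-] := star_vertices_surj s0 Vk; exact: imset_f.
Qed.

End stars.

(** * Submatrices *)

Section submatrices.
Variables n1 n2 : nat.

Lemma submatrices_frequency s x :
  #|[set S in s_submatrices n1 n2 s | x \in S]%SET| * #|{: 'I_n1 * 'I_n2}| =
  #|s_submatrices n1 n2 s| * s.
Proof.
move: x; apply: frequency_symmetric => [S|[i1 i2] [j1 j2]].
  rewrite inE => /existsP[S1 /existsP[S2 /andP[/eqP -> /eqP <-]]].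
  by rewrite finset.cardsX.
pose h (x : 'I_n1 * 'I_n2) := (tperm i1 j1 x.1, tperm i2 j2 x.2).
have hI : injective h by move=> [a b] [a' b'] [/perm_inj -> /perm_inj ->].
exists h; split => //; first by rewrite /h/= !tpermL.
move=> S; rewrite !inE => /existsP[S1 /existsP[S2 /andP[/eqP -> Ss]]].
apply/existsP; exists (tperm i1 j1 @: S1); apply/existsP; exists (tperm i2 j2 @: S2).
rewrite !card_imset ?Ss ?andbT; try exact: perm_inj.
apply/eqP/finset.setP => -[a b]; rewrite finset.in_setX; apply/imsetP/andP.
  by move=> [[a' b']]; rewrite finset.in_setX => /andP[aS bS] [-> ->]; rewrite !imset_f.
move=> [/imsetP[a' aS ->] /imsetP[b' bS ->]]; exists (a', b') => //.
by rewrite finset.in_setX aS.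
Qed.

(** The [r] by [r] products are only some of the shapes with [r ^ 2] entries, hence an inequality.
    As [r > 0], a nonempty product determines both factors through its slices. *)
Lemma card_submatrices r : 0 < r ->
  'C(n1, r) * 'C(n2, r) <= #|s_submatrices n1 n2 (r ^ 2)|.
Proof.
move=> r0; rewrite -!card_s_sets -finset.cardsX.
rewrite -(card_in_imset (f := fun x => finset.setX x.1 x.2)).
  apply/subset_leq_card/fintype.subsetP => _ /imsetP[[S1 S2] + ->].
  rewrite finset.in_setX !inE /= => /andP[/eqP S1r /eqP S2r].
  apply/existsP; exists S1; apply/existsP; exists S2.
  by rewrite eqxx S1r S2r mulnn eqxx.
move=> [S1 S2] [S1' S2'] /=; rewrite !finset.in_setX !inE /=.
move=> /andP[/eqP S1r /eqP S2r] /andP[/eqP S1r' /eqP S2r'] /finset.setP E.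
have [a aS] : exists a, a \in S1 by apply/card_gt0P; rewrite S1r.
have [b bS] : exists b, b \in S2 by apply/card_gt0P; rewrite S2r.
have := E (a, b); rewrite !finset.in_setX aS bS => /esym/andP[aS' bS'].
congr (_, _); apply/finset.setP => x.
  by have := E (x, b); rewrite !finset.in_setX bS bS' !andbT.
by have := E (a, x); rewrite !finset.in_setX aS aS'.
Qed.

End submatrices.

Local Open Scope classical_set_scope.
Local Open Scope ring_scope.

(** * Gaussian change of measure *)

Section gaussian.
Context {R : realType}.
Local Notation leb := (@lebesgue_measure R).
Local Notation N01 := (normal_prob (0 : R) 1).

(** The Radon-Nikodym derivative of the normal law and [normal_pdf] have the same integral over
    every measurable set, so they agree almost everywhere. *)
Lemma ge0_integral_normal_prob (m s : R) (f : R -> \bar R) :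
  measurable_fun [set: R] f -> (forall x, 0 <= f x)%E ->
  (\int[normal_prob m s]_x f x = \int[leb]_x (f x * (normal_pdf m s x)%:E))%E.
Proof.
move=> mf f0; have dom := @normal_prob_dominates R m s.
rewrite -(Radon_Nikodym_SigmaFinite.change_of_variables dom)//.
apply: ae_eq_integral => //.
- apply: emeasurable_funM => //.
  exact: measurable_int (Radon_Nikodym_SigmaFinite.f_integrable dom).
- apply: emeasurable_funM => //.
  by apply/measurable_EFinP; exact: measurable_normal_pdf.
- apply: ae_eqe_mul2l.
  apply: integral_ae_eq => //.
  + exact: Radon_Nikodym_SigmaFinite.f_integrable.
  + by apply/measurable_EFinP; exact: measurable_normal_pdf.
  + by move=> E _ mE; rewrite -Radon_Nikodym_SigmaFinite.f_integral.
Qed.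

(** The image of Lebesgue measure under a translation gives each half-open interval its length, so
    by uniqueness it is Lebesgue measure. *)
Lemma ge0_integral_lebesgue_shift (c : R) (f : R -> \bar R) :
  measurable_fun [set: R] f -> (forall x, 0 <= f x)%E ->
  (\int[leb]_x f (x + c)%R = \int[leb]_x f x)%E.
Proof.
move=> mf f0.
have mc : measurable_fun setT ((fun x => x + c) : R -> measurableTypeR R).
  exact: measurable_funD.
have E : forall A, measurable A ->
    leb A = pushforward leb ((fun x => x + c) : R -> measurableTypeR R) A.
  move=> A mA; apply: lebesgue_measure_unique => //= _ [[a b]] _ <-.
  rewrite /pushforward.
  rewrite [X in _ = leb X](_ : _ = `]a - c, b - c]%classic); last first.
    by apply/seteqP; split => x /=; rewrite !in_itv/= ltrBlDr lerBrDr.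
  rewrite !lebesgue_measure_itv/= !lte_fin ltrD2r; case: ifP => // _.
  by rewrite -!EFinB; congr EFin; ring.
rewrite [RHS](eq_measure_integral (pushforward leb
  ((fun x => x + c) : R -> measurableTypeR R))); last by move=> A mA _; exact: E.
by rewrite ge0_integral_pushforward.
Qed.

(** Cameron-Martin formula in dimension one: the exponential times the standard normal density at
    [y] is the density at [y + c], so translating Lebesgue measure removes [c]. *)
Lemma normal_shift (c : R) (f : R -> \bar R) :
  measurable_fun [set: R] f -> (forall x, 0 <= f x)%E ->
  (\int[N01]_y (f (y + c)%R * (expR (- (c * y) - c ^+ 2 / 2))%:E)
   = \int[N01]_y f y)%E.
Proof.
move=> mf f0.
rewrite !ge0_integral_normal_prob//; first last.
- by move=> x; rewrite mule_ge0// lee_fin expR_ge0.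
- apply: emeasurable_funM.
    by apply: (measurableT_comp mf); exact: measurable_funD.
  apply/measurable_EFinP/measurableT_comp => //.
  apply: measurable_funB => //. apply: measurable_funN; exact: measurable_funM.
rewrite -[RHS](ge0_integral_lebesgue_shift c); first last.
- by move=> x; rewrite mule_ge0// lee_fin normal_pdf_ge0.
- apply: emeasurable_funM => //; apply/measurable_EFinP.
  exact: measurable_normal_pdf.
apply: eq_integral => y _; rewrite -muleA -EFinM; congr (_ * _%:E)%E.
rewrite /normal_pdf oner_eq0 /normal_fun mulrCA -expRD; congr (_ * expR _).
by field.
Qed.

End gaussian.

(** * A normal variable independent of a sub-sigma-algebra *)

Section independence.
Context {d : measure_display} {Omega : measurableType d} {R : realType}.
Variables (P : probability Omega R) (G : set (set Omega)) (V : {RV P >-> R}).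
Hypothesis Gm : <<s G >> `<=` measurable.
Hypothesis indV : forall E B, <<s G >> E -> measurable B ->
  P (E `&` V @^-1` B) = (P E * normal_prob 0 1 B)%E.
Local Notation N01 := (normal_prob (0 : R) 1).
Local Notation OG := (g_sigma_algebraType G).

(** [OG] is [Omega] with the smaller sigma-algebra. By [indV] the joint law of the identity into
    [OG] and of [V] is a product on rectangles, hence everywhere, and Tonelli's theorem applies. *)
Lemma integral_indep_normal (f : OG * R -> \bar R) :
  measurable_fun [set: OG * R] f -> (forall x, 0 <= f x)%E ->
  (\int[P]_w f (w, V w) = \int[P]_w \int[N01]_y f (w, y))%E.
Proof.
move=> mf f0.
have mf' : measurable_fun [set: OG * measurableTypeR R] f by exact: mf.
have mid : measurable_fun [set: Omega] (id : Omega -> OG).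
  by move=> _ B mB; rewrite setTI; exact: Gm.
pose idG : {RV P >-> OG} := HB.pack (id : Omega -> OG)
  (isMeasurableFun.Build _ _ _ _ _ mid).
have mV : measurable_fun [set: Omega] (V : Omega -> measurableTypeR R).
  exact: (measurable_funPT V).
have mpair : measurable_fun [set: Omega]
    (fun w => ((w : OG), (V w : measurableTypeR R))).
  by apply: measurable_fun_pair.
pose pairG : {RV P >-> (OG * measurableTypeR R)%type} :=
  HB.pack (fun w : Omega => ((w : OG), (V w : measurableTypeR R)))
    (isMeasurableFun.Build _ _ _ _ _ mpair).
rewrite -[LHS]/(\int[P]_w (f \o pairG) w)%E -ge0_integral_distribution//.
rewrite -[RHS]/(\int[P]_w (fubini_F N01 f \o idG) w)%E.
rewrite -ge0_integral_distribution; first last.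
- by move=> x; exact: integral_ge0.
- exact: measurable_fun_fubini_tonelli_F.
rewrite -fubini_tonelli1//.
apply: eq_measure_integral => A mA _; apply/esym.
apply: product_measure_unique => //.
Qed.

(** Once the point of [OG] is frozen, [c] is a constant and [normal_shift] applies to the inner
    integral. *)
Lemma normal_change_of_measure (f : OG * R -> \bar R) (c : OG -> R) :
  measurable_fun [set: OG * R] f -> (forall x, 0 <= f x)%E ->
  measurable_fun [set: OG] c ->
  (\int[P]_w (f (w, V w + c w)%R
              * (expR (- (c w * V w) - c w ^+ 2 / 2))%:E)
   = \int[P]_w f (w, V w))%E.
Proof.
move=> mf f0 mc.
have mc1 : measurable_fun [set: OG * R] (fun x => c x.1).
  exact: (measurableT_comp mc).
have m2 : measurable_fun [set: OG * R] (fun x => x.2) by exact: measurable_snd.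
rewrite (integral_indep_normal (f := fun x => (f (x.1, x.2 + c x.1)%R
              * (expR (- (c x.1 * x.2) - c x.1 ^+ 2 / 2))%:E)%E)); first last.
- by move=> x; rewrite mule_ge0// lee_fin expR_ge0.
- apply: emeasurable_funM.
    apply: (measurableT_comp mf); apply: measurable_fun_pair => //=.
    exact: measurable_funD.
  apply/measurable_EFinP/measurableT_comp => //.
  apply: measurable_funB.
    by apply: measurable_funN; exact: measurable_funM.
  by apply: measurable_funM => //; exact: measurable_funX.
rewrite integral_indep_normal//.
apply: eq_integral => w _ /=.
apply: (normal_shift (c w) (f := fun y => f (w, y))) => //.
by apply: (measurableT_comp mf); exact: measurable_fun_pair.
Qed.

End independence.

(** * Isolating one noise term from all other randomness *)

Section leave_one_out.
Context {d : measure_display} {Omega : measurableType d} {R : realType}.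
Context {T : finType} (P : probability Omega R).
Variables (A : nat -> Omega -> T) (Gamma W : nat -> {RV P >-> R}) (m : R).
Hypothesis design : nonadaptive_design A Gamma W m.
Implicit Types B : nat -> set R.

Definition noise_cylinder B : set Omega := [set w | forall i, B i (W i w)].

Definition cylinder_base B :=
  (forall i, measurable (B i)) /\ exists n, forall i, (n <= i)%N -> B i = setT.

(* A pi-system generating the sigma-algebra of the design and of all the noise
   terms except the J-th one. *)
Definition leave_one_out (J : nat) : set (set Omega) :=
  [set E `&` noise_cylinder B | E in sigma_design A Gamma &
                                B in [set B | cylinder_base B /\ B J = setT]].

Lemma sigma_design_measurable : sigma_design A Gamma `<=` measurable.
Proof.
apply: smallest_sub; first exact: sigma_algebra_measurable.
move=> _ [j _] [[B _ <-]|[B mB <-]]; rewrite setTI.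
- rewrite (_ : _ @^-1` _ = \bigcup_(i in B) [set w | A j w = i]).
    apply: fin_bigcup_measurable; first exact: finite_finset.
    by move=> i _; exact: measurable_location design _ _.
  by apply/seteqP; split => [w Bw|w [i Bi /= Awi]]; [exists (A j w)|rewrite /= Awi].
- exact: measurable_funPTI.
Qed.

Lemma sigma_noise_cylinder B : (forall i, measurable (B i)) ->
  sigma_noise W (noise_cylinder B).
Proof.
move=> mB.
rewrite (_ : noise_cylinder B = \bigcap_i (W i @^-1` B i)); last first.
  by apply/seteqP; split => w /= h i; [move=> _; exact: h|exact: h i Logic.I].
pose N := \bigcup_j preimage_set_system [set: Omega] (W j) measurable.
rewrite -[sigma_noise W]/(@measurable _ (g_sigma_algebraType N)).
apply: bigcapT_measurable => i; apply: sub_sigma_algebra.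
by exists i => //; exists (B i) => //; rewrite setTI.
Qed.

Lemma noise_cylinder_measurable B : (forall i, measurable (B i)) ->
  measurable (noise_cylinder B).
Proof.
move=> mB.
rewrite (_ : noise_cylinder B = \bigcap_i (W i @^-1` B i)); last first.
  by apply/seteqP; split => w /= h i; [move=> _; exact: h|exact: h i Logic.I].
by apply: bigcapT_measurable => i; exact: measurable_funPTI.
Qed.

Lemma probability_noise_cylinder n B : (forall i, measurable (B i)) ->
  (forall i, (n <= i)%N -> B i = setT) ->
  P (noise_cylinder B) = (\prod_(i <- iota 0 n) normal_prob 0 1 (B i))%E.
Proof.
move=> mB Bn.
rewrite (_ : noise_cylinder B = \bigcap_(i in [set` iota 0 n]) (W i @^-1` B i)).
  rewrite (noise_independent design)//; last exact: iota_uniq.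
  apply: eq_bigr => i _; exact: (noise_standard_normal design i (mB i)).
apply/seteqP; split => w /= h i; first by move=> _; exact: h.
have [ni|ni] := leqP n i; first by rewrite Bn.
by apply: h; rewrite /= mem_iota.
Qed.

Lemma leave_one_out_measurable J : leave_one_out J `<=` measurable.
Proof.
move=> _ [E dE] [B [[mB _] _] <-]; apply: measurableI.
  exact: sigma_design_measurable.
exact: noise_cylinder_measurable.
Qed.

Lemma leave_one_out_setI_closed J : setI_closed (leave_one_out J).
Proof.
move=> _ _ [E dE] [B [[mB [n Bn]] BJ] <-] [E' dE'] [B' [[mB' [n' Bn']] BJ'] <-].
exists (E `&` E').
  pose D := \bigcup_j (preimage_set_system setT (A j) setT `|`
                 preimage_set_system setT (Gamma j) measurable).
  by apply: (@measurableI _ (g_sigma_algebraType D)).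
exists (fun i => B i `&` B' i).
  split; last by rewrite BJ BJ' setIT.
  split; first by move=> i; exact: measurableI.
  exists (maxn n n') => i; rewrite geq_max => /andP[ni n'i].
  by rewrite Bn// Bn'// setIT.
rewrite setIACA; congr (_ `&` _); apply/seteqP; split => w /=.
  by move=> h; split => i; have [] := h i.
by move=> [h h'] i; split.
Qed.

(** The cylinder leaves [W J] free, so the event on [W J] can be absorbed into it. Independence of
    design and noise, then the product formula for cylinders, splits off the factor of [J]. *)
Lemma leave_one_out_indep J E (B : set R) : leave_one_out J E -> measurable B ->
  P (E `&` W J @^-1` B) = (P E * normal_prob 0 1 B)%E.
Proof.
move=> [D dD] [C [[mC [n Cn]] CJ] <-] mB.
pose C' i := if i == J then B else C i.
have mC' i : measurable (C' i) by rewrite /C'; case: ifP.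
(* The bound exceeds [J], so that the factor of [J] occurs in the finite products compared below. *)
have C'n i : (maxn n J.+1 <= i)%N -> C' i = setT.
  rewrite geq_max /C' => /andP[ni Ji]; rewrite Cn//.
  by rewrite gtn_eqF.
have Cn' i : (maxn n J.+1 <= i)%N -> C i = setT.
  by rewrite geq_max => /andP[ni Ji]; rewrite Cn.
rewrite -setIA (_ : _ `&` W J @^-1` B = noise_cylinder C'); last first.
  apply/seteqP; split => w /=.
    by move=> [h h'] i; rewrite /C'; case: eqP => [->|].
  move=> h; split; last by have := h J; rewrite /C' eqxx.
  by move=> i; have := h i; rewrite /C'; case: eqP => // ->; rewrite CJ.
rewrite !(design_independent_noise design)//; try exact: sigma_noise_cylinder.
rewrite -muleA; congr (_ * _)%E.
rewrite (probability_noise_cylinder mC' C'n) (probability_noise_cylinder mC Cn').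
have Jin : J \in iota 0 (maxn n J.+1) by rewrite mem_iota /= leq_max ltnS leqnn orbT.
rewrite (big_rem J)//= [in RHS](big_rem J)//= CJ /C' eqxx.
rewrite (probability_setT (normal_prob (0:R) 1)) mul1e muleC; congr (_ * _)%E.
apply: eq_big_seq => i; rewrite mem_rem_uniq ?iota_uniq// inE => /andP[/negbTE -> _].
by [].
Qed.

(** As functions of [E] both sides are finite measures; they agree on a pi-system containing the
    whole space, hence on the sigma-algebra it generates. *)
Lemma sigma_leave_one_out_indep J E (B : set R) :
  <<s leave_one_out J >> E -> measurable B ->
  P (E `&` W J @^-1` B) = (P E * normal_prob 0 1 B)%E.
Proof.
move=> sE mB.
have mWB : measurable (W J @^-1` B) by exact: measurable_funPTI.
have [r r0 NBr] : exists2 r : R, 0 <= r & normal_prob 0 1 B = r%:E.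
  have Nfin : normal_prob (0 : R) 1 B \is a fin_num.
    exact: (fin_num_measure (normal_prob (0 : R) 1)).
  by exists (fine (normal_prob 0 1 B)); rewrite ?fineK// fine_ge0// measure_ge0.
pose m2 := mscale (NngNum r0) P.
have m2E F : m2 F = (P F * normal_prob 0 1 B)%E by rewrite NBr muleC.
rewrite -m2E.
apply: (g_sigma_algebra_measure_unique (leave_one_out J) _ (fun=> setT) _ _
  (mrestr P mWB) m2) => //.
- exact: leave_one_out_measurable.
- move=> _; exists setT; first exact: (@measurableT _ (g_sigma_algebraType _)).
  exists (fun=> setT) => //.
    by split => //; split => //; exists 0%N.
  by rewrite setTI; apply/seteqP; split.
- by rewrite bigcup_const.
- exact: leave_one_out_setI_closed.
- move=> F GF; apply: etrans (leave_one_out_indep GF mB) _.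
  exact: esym (m2E F).
- by move=> _; rewrite /= /mrestr setTI ltey_eq fin_num_measure.
Qed.

End leave_one_out.

Lemma measurable_preimage_data {R : realType} {T : finType} {d : measure_display}
    {X : measurableType d} (g : X -> @data R T) :
  (forall j, measurable_fun [set: X] (fun x => (g x j).1.1)) ->
  (forall j i, measurable [set x | (g x j).1.2 = i]) ->
  (forall j, measurable_fun [set: X] (fun x => (g x j).2)) ->
  forall B, data_measurable B -> measurable (g @^-1` B).
Proof.
move=> m1 m2 m3; apply: smallest_sub.
  split; first by rewrite preimage_set0.
    by move=> B mB; rewrite setTD preimage_setC; exact: measurableC.
  by move=> F mF; rewrite preimage_bigcup; exact: bigcup_measurable.
move=> _ [j _] [[[B mB <-]|[B _ <-]]|[B mB <-]]; rewrite setTI.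
- by rewrite -[X in measurable X]setTI; exact: m1.
- rewrite (_ : _ @^-1` _ = \bigcup_(i in B) [set x | (g x j).1.2 = i]).
    by apply: fin_bigcup_measurable; first exact: finite_finset.
  by apply/seteqP; split => [x Bx|x [i Bi /= gi]]; [exists (g x j).1.2|rewrite /= gi].
- by rewrite -[X in measurable X]setTI; exact: m3.
Qed.

(** * Removing the drift one measurement at a time *)

Section change_of_measure.
Context {d : measure_display} {Omega : measurableType d} {R : realType}.
Context {T : finType} (P : probability Omega R).
Variables (A : nat -> Omega -> T) (Gamma W : nat -> {RV P >-> R}) (m : R).
Hypothesis design : nonadaptive_design A Gamma W m.
Variable c : nat -> Omega -> R.
Hypothesis mc : forall j (B : set R), measurable B ->
  sigma_design A Gamma (c j @^-1` B).

(** The drift [e] is expressed in units of the normalised noise. Zero drift gives the null data, and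
    the observations of a support are recovered with the drift [signal_drift]. *)
Definition drifted (e : nat -> Omega -> R) (w : Omega) : data :=
  fun j => ((Num.sqrt (Gamma j w))^-1 * (W j w + e j w), A j w, Gamma j w).

(* The data when only the first J measurements carry the signal. *)
Definition shifted (J : nat) : Omega -> data :=
  drifted (fun j w => if (j < J)%N then c j w else 0).

(** The exponential Z truncated to the first [J] measurements: the likelihood ratio that undoes the
    drift of [shifted J]. *)
Definition weight (J : nat) (w : Omega) : R :=
  \prod_(j < J) expR (- (c j w * W j w) - c j w ^+ 2 / 2).

Lemma inv_sqrt_precisionE j :
  (fun w => (Num.sqrt (Gamma j w))^-1) = (fun x => x `^ (- 2^-1)) \o Gamma j.
Proof.
apply/funext => w /=; rewrite powRN powR12_sqrt// ltW//.
exact: precision_gt0 design j w.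
Qed.

Lemma measurable_drifted (e : nat -> Omega -> R) B :
  (forall j, measurable_fun [set: Omega] (e j)) -> data_measurable B ->
  measurable (drifted e @^-1` B).
Proof.
move=> me; apply: measurable_preimage_data => j.
- apply: measurable_funM; last exact: measurable_funD.
  rewrite inv_sqrt_precisionE; apply: measurableT_comp => //.
- by move=> i; exact: measurable_location design j i.
- exact: measurable_funPT.
Qed.

Lemma measurable_shift_fun j : measurable_fun [set: Omega] (c j).
Proof.
by move=> _ B mB; rewrite setTI; apply: (sigma_design_measurable design); exact: mc.
Qed.

Section measurability.
Variable J : nat.
Local Notation OG := (g_sigma_algebraType (leave_one_out A Gamma W J)).

Lemma sigma_design_leave_one_out :
  sigma_design A Gamma `<=` (measurable : set (set OG)).
Proof.
move=> E dE; apply: sub_sigma_algebra; exists E => //; exists (fun=> setT).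
  by split => //; split => //; exists 0%N.
by rewrite (_ : noise_cylinder _ _ = setT) ?setIT//; apply/seteqP; split.
Qed.

Lemma measurable_shift j : measurable_fun [set: OG] (c j).
Proof.
move=> _ B mB; rewrite setTI; apply: sigma_design_leave_one_out; exact: mc.
Qed.

Lemma measurable_precision j : measurable_fun [set: OG] (Gamma j).
Proof.
move=> _ B mB; apply: sigma_design_leave_one_out; apply: sub_sigma_algebra.
by exists j => //; right; exists B.
Qed.

Lemma measurable_sensed j i : measurable ([set w | A j w = i] : set OG).
Proof.
apply: sigma_design_leave_one_out; apply: sub_sigma_algebra.
by exists j => //; left; exists [set i] => //; rewrite setTI.
Qed.

Lemma measurable_other_noise j : j != J -> measurable_fun [set: OG] (W j).
Proof.
move=> jJ _ B mB; apply: sub_sigma_algebra; exists setT.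
  exact: (@measurableT _ (g_sigma_algebraType _)).
exists (fun i => if i == j then B else setT).
  split; last by rewrite eq_sym (negbTE jJ).
  split; first by move=> i; case: ifP.
  by exists j.+1 => i ji; rewrite gtn_eqF.
congr (_ `&` _); apply/seteqP; split => w /=.
  by move=> /(_ j); rewrite eqxx.
by move=> Bw i; case: eqP => // ->.
Qed.

(** Only noise terms of index below [J] enter, so the weight is part of the randomness that is
    frozen when [W J] is integrated. *)
Lemma measurable_weight : measurable_fun [set: OG] (weight J).
Proof.
rewrite /weight; apply: measurable_prod => /= j _.
have := measurable_shift j; have := @measurable_other_noise j.
rewrite ltn_eqF// => /(_ isT) mW mcj.
apply: measurableT_comp => //; apply: measurable_funB.
  by apply: measurable_funN; exact: measurable_funM.
by apply: measurable_funM => //; exact: measurable_funX.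
Qed.

Lemma measurable_inv_sqrt_precision j :
  measurable_fun [set: OG] (fun w => (Num.sqrt (Gamma j w))^-1).
Proof.
rewrite inv_sqrt_precisionE; apply: measurableT_comp; last exact: measurable_precision.
exact: measurable_powR.
Qed.

(** The second component replaces the [J]-th noise term together with its drift: the value [W J]
    gives [shifted J], and [W J + c J] gives [shifted J.+1]. *)
Definition shifted_with (x : OG * R) : data :=
  fun j => ((Num.sqrt (Gamma j x.1))^-1 *
              (if j == J then x.2
               else W j x.1 + (if (j < J)%N then c j x.1 else 0)),
            A j x.1, Gamma j x.1).

Lemma measurable_shifted_with B : data_measurable B ->
  measurable (shifted_with @^-1` B).
Proof.
apply: measurable_preimage_data => j.
- apply: measurable_funM.
    exact: (measurableT_comp (measurable_inv_sqrt_precision j) measurable_fst).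
  have [_|jJ] := eqVneq j J; first exact: measurable_snd.
  apply: measurable_funD.
    exact: (measurableT_comp (measurable_other_noise jJ) measurable_fst).
  case: (j < J)%N => //.
  exact: (measurableT_comp (measurable_shift j) measurable_fst).
- move=> i; have := measurable_fst measurableT _ (measurable_sensed j i).
  by move=> /(_ _ R); rewrite setTI.
- exact: (measurableT_comp (measurable_precision j) measurable_fst).
Qed.

End measurability.

(* Induction on J: the J-th shift is undone by the Gaussian identity in the J-th
   noise term, all other randomness being frozen. *)
Lemma shifted_change_of_measure J B : data_measurable B ->
  (\int[P]_w ((\1_B (shifted J w))%:E * (weight J w)%:E)
   = P [set w | B (shifted 0 w)])%E.
Proof.
move=> mB; elim: J => [|J IH].
  rewrite (eq_integral (fun w => (\1_[set w | B (shifted 0 w)] w)%:E)).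
    rewrite integral_indic ?setIT//.
    apply: measurable_drifted mB => j; case: (j < 0)%N => //.
    exact: measurable_shift_fun.
  by move=> w _; rewrite /weight big_ord0 mule1.
rewrite -IH.
pose f x := ((\1_B (@shifted_with J x))%:E * (weight J x.1)%:E)%E.
have OGm : <<s leave_one_out A Gamma W J >> `<=` measurable.
  apply: smallest_sub; first exact: sigma_algebra_measurable.
  exact: (leave_one_out_measurable design).
transitivity (\int[P]_w f (w, W J w))%E; last first.
  apply: eq_integral => w _; rewrite /f/=; congr ((\1_B _)%:E * _)%E.
  apply/funext => j; rewrite /shifted_with /shifted/drifted/=.
  by case: eqP => // ->; rewrite ltnn addr0.
have indJ := sigma_leave_one_out_indep design (J := J).
rewrite -(normal_change_of_measure OGm indJ (c := c J)).
- apply: eq_integral => w _; rewrite /f/= -!muleA; congr ((\1_B _)%:E * _)%E.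
    apply/funext => j; rewrite /shifted_with /shifted/drifted/=.
    case: eqP => [->|/eqP jJ]; first by rewrite ltnS leqnn.
    by rewrite ltnS [in RHS]ltn_neqAle jJ.
  by rewrite -EFinM /weight big_ord_recr.
- apply: emeasurable_funM.
    apply/measurable_EFinP.
    exact: (measurable_indic (D := setT) (measurable_shifted_with mB)).
  apply/measurable_EFinP.
  exact: (measurableT_comp (measurable_weight (J := J)) measurable_fst).
- move=> x; rewrite mule_ge0// lee_fin//.
  by apply: prodr_ge0 => j _; exact: expR_ge0.
- exact: measurable_shift.
Qed.

End change_of_measure.

Section weight_integral.
Context {d : measure_display} {Omega : measurableType d} {R : realType}.
Context {T : finType} (P : probability Omega R).
Variables (A : nat -> Omega -> T) (Gamma W : nat -> {RV P >-> R}) (m : R).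
Hypothesis design : nonadaptive_design A Gamma W m.
Variable c : nat -> Omega -> R.
Hypothesis mc : forall j (B : set R), measurable B ->
  sigma_design A Gamma (c j @^-1` B).
Local Open Scope ereal_scope.

Lemma data_measurableT : data_measurable [set: @data R T].
Proof. by rewrite -setC0 -setTD; apply: sigma_algebraCD; exact: sigma_algebra0. Qed.

Lemma measurable_fun_weight J : measurable_fun [set: Omega] (weight W c J).
Proof.
rewrite /weight; apply: measurable_prod => /= j _.
have mcj := measurable_shift_fun design mc j.
apply: measurableT_comp => //; apply: measurable_funB.
  by apply: measurable_funN; apply: measurable_funM.
by apply: measurable_funM => //; exact: measurable_funX.
Qed.

(** This is the change of measure for the sure event. *)
Lemma integral_weight J : \int[P]_w (weight W c J w)%:E = 1.
Proof.
have := shifted_change_of_measure design mc J data_measurableT.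
rewrite (_ : [set w | _] = setT); last exact/seteqP.
rewrite probability_setT => <-.
by apply: eq_integral => w _; rewrite indicT mul1e.
Qed.

Lemma weight_ge0 J w : (0 <= weight W c J w)%R.
Proof. by apply: prodr_ge0 => j _; exact: expR_ge0. Qed.

End weight_integral.

(** * From the change of measure to a bound on probabilities *)

Section shift_bound.
Context {d : measure_display} {Omega : measurableType d} {R : realType}.
Context {T : finType} (P : probability Omega R).
Variables (A : nat -> Omega -> T) (Gamma W : nat -> {RV P >-> R}) (m : R).
Hypothesis design : nonadaptive_design A Gamma W m.
Variable c : nat -> Omega -> R.
Hypothesis mc : forall j (B : set R), measurable B ->
  sigma_design A Gamma (c j @^-1` B).
Local Open Scope ereal_scope.

(* The weight of -c absorbs the linear term sum_j c_j W_j, so that only integrals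
   of nonnegative functions are needed. *)
Lemma weight_entropy_ineq (b : bool) (t : R) J w :
  (t * b%:R + 2 <= weight W (fun j w => - c j w) J w + \sum_(j < J) c j w ^+ 2 +
     (weight W c J w + (expR t - 1) * (b%:R * weight W c J w)))%R.
Proof.
rewrite /weight -!expR_sum.
set a := (\sum_(j < J) c j w * W j w)%R; set q := (\sum_(j < J) c j w ^+ 2)%R.
have -> : (\sum_(j < J) (- (c j w * W j w) - c j w ^+ 2 / 2) = - a - q / 2)%R.
  by rewrite /a /q mulr_suml -sumrN -sumrB.
have -> : (\sum_(j < J) (- (- c j w * W j w) - (- c j w) ^+ 2 / 2) = a - q / 2)%R.
  by rewrite /a /q mulr_suml -sumrB; apply: eq_bigr => j _; ring.
(* Adding [1 + x <= expR x] at this point and at [t - a - q / 2], or at [- a - q / 2] when [b] is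
   false, cancels [a] and leaves [- q]. *)
have e1 := expR_ge1Dx (a - q / 2).
case: b; rewrite !(mulr1n, mulr0n, mulr1, mulr0, mul1r, mul0r, addr0).
  have := expR_ge1Dx (t + (- a - q / 2)); rewrite expRD; lra.
have := expR_ge1Dx (- a - q / 2); lra.
Qed.

(** Integrates [weight_entropy_ineq] with [b] the indicator of the event: both weights have integral
    1, and the weighted indicator integrates to the null probability. *)
Lemma shifted_bound (t : R) J B : (0 <= t)%R -> data_measurable B ->
  t%:E * P (shifted A Gamma W c J @^-1` B) <=
  \int[P]_w (\sum_(j < J) c j w ^+ 2)%:E +
  (expR t - 1)%:E * P (shifted A Gamma W c 0 @^-1` B).
Proof.
move=> t0 mB.
have mc' j (C : set R) : measurable C ->
    sigma_design A Gamma ((fun w => - c j w)%R @^-1` C).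
  move=> mC; apply: (mc j (B := [set x | C (- x)%R])).
  by rewrite -[X in measurable X]setTI; exact: oppr_measurable.
have mZ := measurable_fun_weight design mc J.
have mZ' := measurable_fun_weight design mc' J.
have mE : measurable (shifted A Gamma W c J @^-1` B).
  apply: (measurable_drifted design) => // j; case: (j < J)%N => //.
  exact: (measurable_shift_fun design mc).
have mq : measurable_fun [set: Omega] (fun w => \sum_(j < J) c j w ^+ 2)%R.
  apply: measurable_sum => j; apply: measurable_funX.
  exact: (measurable_shift_fun design mc).
have et : (0 <= expR t - 1)%R by have := expR_ge1Dx t; lra.
set E := shifted A Gamma W c J @^-1` B.
have mI : measurable_fun setT (\1_E : Omega -> R) by exact: measurable_indic.
have lhs : \int[P]_w (t * \1_E w + 2)%:E = t%:E * P E + 2%:E.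
  under eq_integral do rewrite EFinD EFinM.
  rewrite ge0_integralD//; last 2 first.
  - by move=> w _; rewrite mule_ge0// lee_fin.
  - by apply/measurable_EFinP; exact: measurable_funM.
  rewrite ge0_integralZl//; last by apply/measurable_EFinP.
  by rewrite integral_indic// setIT integral_cst//= probability_setT mule1.
have rhs : \int[P]_w (weight W (fun j w => - c j w) J w + \sum_(j < J) c j w ^+ 2 +
     (weight W c J w + (expR t - 1) * (\1_E w * weight W c J w)))%:E =
     1 + \int[P]_w (\sum_(j < J) c j w ^+ 2)%:E +
     (1 + (expR t - 1)%:E * P (shifted A Gamma W c 0 @^-1` B)).
  under eq_integral do rewrite EFinD EFinD [in X in _ + X]EFinD EFinM EFinM.
  have mZE : measurable_fun setT (fun w => (\1_E w)%:E * (weight W c J w)%:E).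
    by apply: emeasurable_funM; exact/measurable_EFinP.
  have ZE0 w : 0 <= (\1_E w)%:E * (weight W c J w)%:E.
    by apply: mule_ge0; rewrite lee_fin ?weight_ge0.
  have etZE0 w : 0 <= (expR t - 1)%:E * ((\1_E w)%:E * (weight W c J w)%:E).
    exact: mule_ge0.
  rewrite ge0_integralD//; last 4 first.
  - move=> w _; rewrite adde_ge0// lee_fin ?weight_ge0// sumr_ge0// => j _.
    exact: sqr_ge0.
  - by apply: emeasurable_funD; exact/measurable_EFinP.
  - by move=> w _; apply: adde_ge0 => //; rewrite lee_fin weight_ge0.
  - apply: emeasurable_funD; first exact/measurable_EFinP.
    exact: measurable_funeM.
  rewrite ge0_integralD//; last 4 first.
  - by move=> w _; rewrite lee_fin weight_ge0.
  - exact/measurable_EFinP.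
  - by move=> w _; rewrite lee_fin sumr_ge0// => j _; exact: sqr_ge0.
  - exact/measurable_EFinP.
  rewrite (integral_weight design mc'); congr (_ + _).
  rewrite ge0_integralD//; last 3 first.
  - by move=> w _; rewrite lee_fin weight_ge0.
  - exact/measurable_EFinP.
  - exact: measurable_funeM.
  rewrite (integral_weight design mc); congr (_ + _).
  rewrite ge0_integralZl//.
  congr (_ * _); exact: (shifted_change_of_measure design mc J mB).
have : t%:E * P E + 2%:E <= 1 + \int[P]_w (\sum_(j < J) c j w ^+ 2)%:E +
     (1 + (expR t - 1)%:E * P (shifted A Gamma W c 0 @^-1` B)).
  rewrite -lhs -rhs; apply: ge0_le_integral => //.
  - by move=> w _; rewrite lee_fin addr_ge0// mulr_ge0.
  - apply/measurable_EFinP; apply: measurable_funD => //.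
    exact: measurable_funM.
  - apply/measurable_EFinP; apply: measurable_funD; apply: measurable_funD => //.
    by apply: measurable_funM => //; exact: measurable_funM.
  - move=> w _; rewrite lee_fin indicE; exact: weight_entropy_ineq.
(* The constant 2 on the left cancels the two total masses 1 on the right. *)
rewrite addeACA -EFinD [leRHS]addeC leeD2rE//.
Qed.

End shift_bound.

(** * Approximation by cylinders and the lower bound *)

Section approximation.
Context {d : measure_display} {Omega : measurableType d} {R : realType}.
Variables (P : probability Omega R) (Y : Type) (I : finType).
Variables (g : I -> Omega -> Y) (C : set (set Y)).
Hypothesis mC : forall i B, C B -> measurable (g i @^-1` B).
Hypothesis C0 : C set0.
Hypothesis CC : forall B, C B -> C (~` B).
Hypothesis CU : forall B B', C B -> C B' -> C (B `|` B').
Local Open Scope ereal_scope.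

(** The same [B'] must serve every [g i]: the signal data and the null data will be approximated by
    one common cylinder. *)
Definition approximable (B : set Y) := forall e : R, (0 < e)%R ->
  exists2 B', C B' & forall i, P (g i @^-1` (B `+` B')) < e%:E.

Lemma measurable_sigma_preimage i B : <<s C >> B -> measurable (g i @^-1` B).
Proof.
move: B; apply: smallest_sub; last exact: mC.
split; first by rewrite preimage_set0.
  by move=> B mB; rewrite setTD preimage_setC; exact: measurableC.
by move=> F mF; rewrite preimage_bigcup; exact: bigcup_measurable.
Qed.

Lemma measurable_preimage_setY i B B' : <<s C >> B -> <<s C >> B' ->
  measurable (g i @^-1` (B `+` B')).
Proof.
move=> mB mB'; rewrite (_ : _ @^-1` _ = (g i @^-1` B `\` g i @^-1` B') `|`
   (g i @^-1` B' `\` g i @^-1` B))//.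
by apply: measurableU; apply: measurableD; exact: measurable_sigma_preimage.
Qed.

(** Approximable sets form a sigma-algebra. A countable union is replaced by a finite one at cost
    [e / 2], by continuity from above, and the finite one is approximated within [e / 2]. *)
Lemma sigma_approximable B : <<s C >> B -> approximable B.
Proof.
have sC := @sub_sigma_algebra _ setT C.
(* Membership in the sigma-algebra is carried along because the union step needs the preimages to be
   measurable. *)
suff : <<s C >> `<=` [set B | <<s C >> B /\ approximable B].
  by move=> + sB => /(_ _ sB)[].
apply: smallest_sub; last first.
  move=> D CD; split; first exact: sC.
  move=> e e0; exists D => // i.
  by rewrite setYK preimage_set0 measure0.
split.
- split; first exact: sC.
  move=> e e0; exists set0 => // i.
  by rewrite setYK preimage_set0 measure0.
- move=> D [mD aD]; split; first exact: sigma_algebraCD.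
  move=> e /aD[D' CD' DD']; exists (~` D'); first exact: CC.
  move=> i; rewrite (_ : _ `+` _ = D `+` D')//.
  by rewrite setTD; apply/seteqP; split => y /= [] [] h1 h2;
    [right|left|right|left]; split => //; apply: contrapT.
move=> F aF; split; first by apply: sigma_algebra_bigcup => n; case: (aF n).
have mF n : <<s C >> (F n) by case: (aF n).
pose V n := \bigcup_(j < n) F j.
have mV n : <<s C >> (V n).
  rewrite /V bigcup_mkcond; apply: sigma_algebra_bigcup => j.
  by case: ifP => // _; exact: sigma_algebra0.
have aV n : approximable (V n).
  elim: n => [|n IH] e e0.
    exists set0 => // i; rewrite /V bigcup_mkord big_ord0.
    by rewrite setYK preimage_set0 measure0.
  have e20 : (0 < e / 2)%R by rewrite divr_gt0.
  have [D1 CD1 h1] := IH _ e20; have [D2 CD2 h2] := (aF n).2 _ e20.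
  exists (D1 `|` D2); first exact: CU.
  move=> i; rewrite [e]splitr EFinD.
  apply: le_lt_trans (lteD (h1 i) (h2 i)).
  apply: le_trans (measureU2 _ _ _); first last.
  + by apply: measurable_preimage_setY => //; exact: sC.
  + by apply: measurable_preimage_setY => //; exact: sC.
  apply: le_measure; rewrite ?inE.
  + by apply: measurable_preimage_setY => //; apply: sC; exact: CU.
  + by apply: measurableU; apply: measurable_preimage_setY => //; exact: sC.
  rewrite /V bigcup_mkord big_ord_recr/= -bigcup_mkord.
  by move=> w /= [[[h|h] /not_orP[]]|[[h|h] /not_orP[]]];
    [left; left|right; left|left; right|right; right].
move=> e e0; have e20 : (0 < e / 2)%R by rewrite divr_gt0.
have mU i k : measurable (g i @^-1` (\bigcup_j F j `\` V k)).
  rewrite [X in measurable X](_ : _ = g i @^-1` (\bigcup_j F j) `\` g i @^-1` V k)//.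
  apply: measurableD; apply: measurable_sigma_preimage => //.
  exact: sigma_algebra_bigcup.
have tail i : exists n, forall k, (n <= k)%N ->
    P (g i @^-1` (\bigcup_j F j `\` V k)) < (e / 2)%:E.
  have cap0 : \bigcap_k (g i @^-1` (\bigcup_j F j `\` V k)) = set0.
    rewrite -subset0 => w h; have [[j _ Fj] _] := h 0%N Logic.I.
    have [_] := h j.+1 Logic.I; apply; exists j => //=; exact: ltnSn.
  have : P \o (fun k => g i @^-1` (\bigcup_j F j `\` V k)) @ \oo --> 0.
    rewrite -(measure0 P) -cap0; apply: nonincreasing_cvg_mu => //.
    - by rewrite ltey_eq fin_num_measure.
    - by rewrite cap0.
    - move=> k l kl; apply/subsetPset => w /= [Uw nV]; split => //.
      by apply: contra_not nV => -[j /= jk Fj]; exists j => //=; exact: leq_trans jk kl.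
  move=> /(_ [set x | x < (e / 2)%:E])[].
    by apply: open_nbhs_nbhs; split; [exact: open_ereal_lt_ereal|rewrite /= lte_fin].
  by move=> k _ hk; exists k => l kl; exact: hk.
(* As [I] is finite, the largest of the individual ranks works for all [i]. *)
have [n hn] : exists n, forall i, P (g i @^-1` (\bigcup_j F j `\` V n)) < (e / 2)%:E.
  exists (\max_i projT1 (cid (tail i)))%N => i.
  by apply: (projT2 (cid (tail i))); exact: leq_bigmax.
have [D CD hD] := aV n _ e20.
exists D => // i; rewrite [e]splitr EFinD.
apply: le_lt_trans (lteD (hn i) (hD i)).
apply: le_trans (measureU2 _ _ _); first last.
- by apply: measurable_preimage_setY => //; exact: sC.
- exact: mU.
apply: le_measure; rewrite ?inE.
- apply: measurable_preimage_setY; last exact: sC.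
  exact: sigma_algebra_bigcup.
- apply: measurableU; first exact: mU.
  by apply: measurable_preimage_setY => //; exact: sC.
move=> w /= [[[j _ Fj] nD]|[Dw nF]].
  have [Vw|nV] := pselect (V n (g i w)); first by right; left.
  by left; split => //; exists j.
right; right; split => // -[j _ Fj]; apply: nF; by exists j.
Qed.

End approximation.

Section cylinder_approximation.
Context {R : realType} {T : finType}.

(** Events decided by the first [n] measurements, for which a drift on finitely many measurements is
    enough. *)
Definition data_cylinder : set (set (@data R T)) :=
  [set B | data_measurable B /\
     exists n, forall u v, (forall j, (j < n)%N -> u j = v j) -> B u -> B v].

Lemma data_cylinder0 : data_cylinder set0.
Proof. by split; [exact: sigma_algebra0|exists 0%N]. Qed.

Lemma data_cylinderC B : data_cylinder B -> data_cylinder (~` B).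
Proof.
move=> [mB [n Bn]]; split; first by rewrite -setTD; exact: sigma_algebraCD.
by exists n => u v uv nBu; apply: contra_not nBu; apply: Bn => j jn; rewrite uv.
Qed.

Lemma data_cylinderU B B' : data_cylinder B -> data_cylinder B' ->
  data_cylinder (B `|` B').
Proof.
move=> [mB [n Bn]] [mB' [n' Bn']]; split.
  rewrite -bigcup2E; apply: sigma_algebra_bigcup => -[|[|i]]//=.
  exact: sigma_algebra0.
exists (maxn n n') => u v uv [Bu|Bu]; [left; apply: Bn Bu|right; apply: Bn' Bu].
  by move=> j jn; apply: uv; rewrite leq_max jn.
by move=> j jn; apply: uv; rewrite leq_max jn orbT.
Qed.

Lemma data_measurable_cylinder B : data_measurable B -> <<s data_cylinder >> B.
Proof.
move: B; apply: smallest_sub; first exact: smallest_sigma_algebra.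
move=> D Dj; apply: sub_sigma_algebra; split; first exact: sub_sigma_algebra.
case: Dj => j _ [[[B' _ <-]|[B' _ <-]]|[B' _ <-]];
  exists j.+1 => u v /(_ j (ltnSn j)) uv;
  by rewrite !setTI /= uv.
Qed.

End cylinder_approximation.

Lemma le_measure_setY {d : measure_display} {Omega : measurableType d} {R : realType}
    (P : {measure set Omega -> \bar R}) (X Y : set Omega) :
  measurable X -> measurable Y -> (P X <= P Y + P (X `+` Y))%E.
Proof.
move=> mX mY.
have mXY : measurable (X `+` Y) by apply: measurableU; exact: measurableD.
apply: le_trans (measureU2 _ mY mXY).
apply: le_measure; rewrite ?inE//; first exact: measurableU.
by move=> w Xw; have [Yw|nYw] := pselect (Y w); [left|right; left].
Qed.

(** * The bound for the full sequence of observations *)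

Section observation_bound.
Context {d : measure_display} {Omega : measurableType d} {R : realType}.
Context {T : finType} (P : probability Omega R).
Variables (A : nat -> Omega -> T) (Gamma W : nat -> {RV P >-> R}) (m : R).
Hypothesis design : nonadaptive_design A Gamma W m.
Variables (mu : R) (S : {set T}).

Definition signal_drift (j : nat) (w : Omega) : R :=
  if A j w \in S then mu * Num.sqrt (Gamma j w) else 0.

Lemma observation_drifted :
  observation A Gamma W mu S = drifted A Gamma W signal_drift.
Proof.
apply/funext => w; apply/funext => j.
rewrite /observation /drifted /signal /signal_drift.
congr (_, _, _); rewrite mulrDr addrC; congr +%R.
case: ifP; rewrite ?mulr0// => _; rewrite mulrCA mulVf ?mulr1//.
by rewrite gt_eqF// sqrtr_gt0; exact: precision_gt0 design j w.
Qed.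

Lemma signal_drift_measurable j (B : set R) : measurable B ->
  sigma_design A Gamma (signal_drift j @^-1` B).
Proof.
move=> mB.
pose D := \bigcup_j (preimage_set_system setT (A j) setT `|`
                 preimage_set_system setT (Gamma j) measurable).
have mA : measurable_fun [set: g_sigma_algebraType D] (fun w => A j w \in S).
  move=> _ Y _; apply: sub_sigma_algebra; exists j => //; left.
  by exists [set i | Y (i \in S)].
have mG : measurable_fun [set: g_sigma_algebraType D] (Gamma j).
  by move=> _ Y mY; apply: sub_sigma_algebra; exists j => //; right; exists Y.
have : measurable_fun [set: g_sigma_algebraType D] (signal_drift j).
  apply: measurable_fun_ifT => //; apply: measurable_funM => //.
  apply: measurableT_comp mG.
  by apply: continuous_measurable_fun; exact: sqrt_continuous.
by move=> /(_ measurableT B mB); rewrite setTI.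
Qed.

Lemma measurable_observation B : data_measurable B ->
  measurable (observation A Gamma W mu S @^-1` B).
Proof.
rewrite observation_drifted; apply: (measurable_drifted design) => j.
exact: (measurable_shift_fun design signal_drift_measurable).
Qed.

Definition sensed_precision : \bar R :=
  (\int[P]_w \sum_(0 <= j <oo) (if A j w \in S then Gamma j w else 0)%:E)%E.

Lemma sensed_ge0 j w : 0 <= (if A j w \in S then Gamma j w else 0).
Proof. by case: ifP => // _; apply/ltW; exact: precision_gt0 design j w. Qed.

Lemma sensed_precision_ge0 : (0 <= sensed_precision)%E.
Proof.
apply: integral_ge0 => w _; apply: nneseries_ge0 => j _ _.
by rewrite lee_fin sensed_ge0.
Qed.

Lemma measurable_sensed_series : measurable_fun [set: Omega]
  (fun w => \sum_(0 <= j <oo) (if A j w \in S then Gamma j w else 0)%:E)%E.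
Proof.
apply: (@ge0_emeasurable_sum _ _ _ _ _ predT) => [j w _ _|j _].
  by rewrite lee_fin sensed_ge0.
apply/measurable_EFinP; apply: measurable_fun_ifT => // _ Y _.
apply: (sigma_design_measurable design); apply: sub_sigma_algebra.
by exists j => //; left; exists [set i | Y (i \in S)].
Qed.

Lemma integral_drift_le n :
  (\int[P]_w (\sum_(j < n) signal_drift j w ^+ 2)%:E
   <= (mu ^+ 2)%:E * sensed_precision)%E.
Proof.
have mser := measurable_sensed_series.
rewrite /sensed_precision -ge0_integralZl//; last 2 first.
- by move=> w _; apply: nneseries_ge0 => j _ _; rewrite lee_fin sensed_ge0.
- by rewrite lee_fin sqr_ge0.
apply: ge0_le_integral => //.
- by move=> w _; rewrite lee_fin sumr_ge0// => j _; exact: sqr_ge0.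
- apply/measurable_EFinP; apply: measurable_sum => j; apply: measurable_funX.
  exact: (measurable_shift_fun design signal_drift_measurable).
- exact: measurable_funeM.
move=> w _; apply: (@le_trans _ _ ((mu ^+ 2)%:E *
    (\sum_(0 <= j < n) (if A j w \in S then Gamma j w else 0)%:E))%E).
  rewrite sumEFin -EFinM lee_fin big_mkord mulr_sumr; apply: ler_sum => j _.
  rewrite /signal_drift; case: ifP => _; last by rewrite expr0n mulr0.
  by rewrite exprMn sqr_sqrtr// ltW//; exact: precision_gt0 design j w.
rewrite lee_wpmul2l ?lee_fin ?sqr_ge0//; apply: nneseries_lim_ge => j _ _.
by rewrite lee_fin sensed_ge0.
Qed.

(** Passes from finitely many drifts to all of them: [B] is replaced by a cylinder close to it under
    both the signal and the null law, and [shifted_bound] is applied to the cylinder. *)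
Lemma observation_bound (t : R) (B : set data) : 0 <= t -> data_measurable B ->
  (t%:E * P (observation A Gamma W mu S @^-1` B)
   <= (mu ^+ 2)%:E * sensed_precision
      + (expR t - 1)%:E * P (drifted A Gamma W (fun _ _ => 0%R) @^-1` B))%E.
Proof.
move=> t0 mB.
have et : 0 <= expR t - 1 by have := expR_ge1Dx t; lra.
have mc := signal_drift_measurable.
pose g (b : bool) := if b then observation A Gamma W mu S
                     else drifted A Gamma W (fun _ _ => 0%R).
have mg b D : data_measurable D -> measurable (g b @^-1` D).
  by case: b => mD; [exact: measurable_observation|exact: (measurable_drifted design)].
apply/lee_addgt0Pr => e e0.
(* The approximation is used twice, with factors [t] and [expR t - 1], so an error of [e] divided by
   this quantity costs at most [e] in total. *)
have k0 : 0 < expR t + t by rewrite ltr_pwDl// expR_gt0.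
have d0 : 0 < e / (expR t + t) by rewrite divr_gt0.
have mgC b D : data_cylinder D -> measurable (g b @^-1` D) by move=> [/mg].
have [D [mD [n Dn]] hD] := sigma_approximable P mgC
  data_cylinder0 data_cylinderC data_cylinderU
  (data_measurable_cylinder mB) d0.
move: hD; set dl := (e / _); move=> hD.
have dle0 : (0 <= dl%:E)%E by rewrite lee_fin ltW.
have le1 : (P (g true @^-1` B) <= P (g true @^-1` D) + dl%:E)%E.
  apply: le_trans (le_measure_setY P (mg true _ mB) (mg true _ mD)) _.
  by rewrite leeD2l// ltW// (hD true).
have le2 : (P (g false @^-1` D) <= P (g false @^-1` B) + dl%:E)%E.
  apply: le_trans (le_measure_setY P (mg false _ mD) (mg false _ mB)) _.
  by rewrite leeD2l// ltW// setYC (hD false).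
(* [D] depends only on the first [n] measurements, and there [shifted] with [n] carries the full
   drift. *)
have obsD : g true @^-1` D = shifted A Gamma W signal_drift n @^-1` D.
  rewrite /g observation_drifted.
  by apply/seteqP; split => w /=; apply: Dn => j jn; rewrite /shifted /drifted jn.
have := shifted_bound design mc n t0 mD.
rewrite -obsD => hn.
apply: (@le_trans _ _ (t%:E * (P (g true @^-1` D) + dl%:E))%E).
  exact: lee_wpmul2l.
rewrite (ge0_muleDr _ (measure_ge0 P _) dle0).
apply: (@le_trans _ _ ((mu ^+ 2)%:E * sensed_precision +
  (expR t - 1)%:E * (P (g false @^-1` B) + dl%:E) + t%:E * dl%:E)%E).
  apply: leeD => //; apply: le_trans hn _; apply: leeD; first exact: integral_drift_le.
  apply: lee_wpmul2l; rewrite ?lee_fin//.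
rewrite (ge0_muleDr _ (measure_ge0 P _) dle0) addeA.
rewrite -[leLHS]addeA; apply: leeD2l.
rewrite -!EFinM -EFinD lee_fin -mulrDl.
rewrite /dl mulrCA; apply: ler_piMr; first exact: ltW.
by rewrite ler_pdivrMr// mul1r; lra.
Qed.

End observation_bound.

(** * Averaging over a family of supports *)

Section recoverable_bound.
Context {R : realType} {T : finType}.
Variables (F : {set {set T}}) (q : nat).
Hypothesis freq : forall i : T,
  (#|[set S in F | i \in S]%SET| * #|T| <= #|F| * q)%N.

(** After exchanging the sums, each [Gamma j] is counted once for every member of [F] containing the
    sensed location; [freq] bounds that number uniformly and the budget bounds the rest. *)
Lemma sum_sensed_precision {d : measure_display} {Omega : measurableType d}
    {P : probability Omega R} (A : nat -> Omega -> T) (Gamma W : nat -> {RV P >-> R})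
    (m : R) : nonadaptive_design A Gamma W m ->
  (#|T|%:R%:E * \sum_(S in F) sensed_precision A Gamma S <= (#|F| * q)%:R%:E * m%:E)%E.
Proof.
move=> design.
have I0 (S : {set T}) j w : 0 <= (if A j w \in S then Gamma j w else 0).
  exact: sensed_ge0 design S j w.
have mser := measurable_sensed_series design.
have G0 j w : (0 <= (Gamma j w)%:E)%E.
  by rewrite lee_fin; apply/ltW; exact: precision_gt0 design j w.
have mG : measurable_fun [set: Omega] (fun w => \sum_(0 <= j <oo) (Gamma j w)%:E)%E.
  apply: (@ge0_emeasurable_sum _ _ _ _ _ predT) => // k _.
  exact/measurable_EFinP.
rewrite /sensed_precision -big_enum /= -ge0_integral_sum//; last first.
  by move=> S w _; apply: nneseries_ge0 => j _ _; rewrite lee_fin.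
rewrite -ge0_integralZl//; last 2 first.
- exact: emeasurable_sum.
- move=> w _; apply: sume_ge0 => S _; apply: nneseries_ge0 => j _ _; by rewrite lee_fin.
apply: le_trans (lee_wpmul2l _ (precision_budget design)); last by rewrite lee_fin.
rewrite -ge0_integralZl//; last first.
  by move=> w _; exact: nneseries_ge0.
apply: ge0_le_integral => //.
- move=> w _; apply: mule_ge0; first by rewrite lee_fin.
  by apply: sume_ge0 => S _; apply: nneseries_ge0 => j _ _; rewrite lee_fin.
- by apply: measurable_funeM; exact: emeasurable_sum.
- exact: measurable_funeM.
move=> w _; rewrite -nneseries_sum; last by move=> S j _; rewrite lee_fin.
rewrite -!nneseriesZl//; last first.
  by move=> j _; apply: sume_ge0 => S _; rewrite lee_fin.
apply: lee_nneseries => [j _ _|j _].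
  by apply: mule_ge0; [rewrite lee_fin|apply: sume_ge0 => S _; rewrite lee_fin].
rewrite sumEFin -!EFinM lee_fin big_enum/= -big_mkcondr/= sumr_const.
rewrite -[Gamma j w *+ _]mulr_natr mulrCA [leRHS]mulrC.
apply: ler_wpM2l; first by rewrite -lee_fin.
rewrite -natrM ler_nat mulnC; apply: leq_trans (freq (A j w)).
by rewrite cardsE.
Qed.

(** Under one fixed law the events that the estimator returns [S] are disjoint for different [S]. *)
Lemma null_recovery_le1 {d : measure_display} {Omega : measurableType d}
    {P : probability Omega R} (g : Omega -> @data R T) (Shat : @data R T -> {set T}) :
  (forall S, measurable (g @^-1` [set u | Shat u = S])) ->
  (\sum_(S in F) P (g @^-1` [set u | Shat u = S]) <= 1)%E.
Proof.
move=> mS; rewrite -big_enum/=.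
rewrite (eq_bigr (fun S => \int[P]_w (\1_(g @^-1` [set u | Shat u = S]) w)%:E)%E);
  last by move=> S _; rewrite integral_indic// setIT.
rewrite -ge0_integral_sum//; last first.
  by move=> S; apply/measurable_EFinP; exact: measurable_indic.
apply: (@le_trans _ _ (\int[P]_w 1)%E); last first.
  by rewrite integral_cst//= probability_setT mule1.
apply: ge0_le_integral => //.
- by move=> w _; apply: sume_ge0 => S _; rewrite lee_fin.
- by apply: emeasurable_sum => S; apply/measurable_EFinP; exact: measurable_indic.
move=> w _; rewrite sumEFin lee_fin big_enum/=.
rewrite (eq_bigr (fun S => (Shat (g w) == S)%:R)); last first.
  move=> S _; rewrite indicE; congr (nat_of_bool _)%:R.
  by apply/idP/eqP => [/set_mem|Sg]; [|exact: mem_set].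
rewrite big_mkcond (bigD1 (Shat (g w)))//= eqxx big1 => [|S /negbTE nS].
  by rewrite addr0; case: ifP.
by rewrite eq_sym nS; case: ifP.
Qed.

End recoverable_bound.

(** Recovery over [C] entails recovery over [F], so a subfamily with balanced coordinates suffices;
    [N] need only bound its size from below. *)
Lemma recoverable_lower_bound {R : realType} {T : finType} (C F : {set {set T}})
    (m mu eps : R) (q N : nat) :
  0 < m -> 0 < mu -> 0 < eps -> (0 < q)%N ->
  F \subset C -> (N <= #|F|)%N ->
  (forall i : T, (#|[set S in F | i \in S]%SET| * #|T| <= #|F| * q)%N) ->
  1 + Num.sqrt 2 <= (1 - 2 * eps) * ln (N%:R - 1) ->
  recoverable C m mu eps ->
  Num.sqrt ((1 - 2 * eps) * (#|T|%:R / (2 * q%:R * m)) * ln (N%:R - 1)) <= mu.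
Proof.
move=> m0 mu0 eps0 q0 FC NF freq hN.
move=> [d [Om [P [A [Gamma [W [Shat [design mShat err]]]]]]]].
set l := ln (N%:R - 1) in hN *.
have sqrt2 : 1 <= Num.sqrt (2 : R) by rewrite -[leLHS]sqrtr1 ler_wsqrtr// ler1n.
have l_ge0 : 0 <= l.
  (* For [N <= 1] the logarithm takes its default value 0. *)
  have [N1|N1] := leP (N%:R : R) 1; first by rewrite /l ln0// subr_le0.
  move: N1; rewrite ltr1n => N1; apply: ln_ge0.
  by rewrite lerBrDr -(natrD _ 1 1) ler_nat.
have l2 : 2 <= l.
  have : l * (1 - 2 * eps) <= l by rewrite ler_piMr//; lra.
  lra.
have N1 : 0 < (N%:R - 1 : R).
  by rewrite ltNge; apply/negP => /ln0; rewrite -/l; lra.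
have el : expR l = N%:R - 1 by rewrite lnK.
have epsl : 0 < 1 - 2 * eps by nra.
pose K := (\sum_(S in F) sensed_precision A Gamma S)%E.
pose p0 S := P (drifted A Gamma W (fun _ _ => 0) @^-1` [set u | Shat u = S]).
have K0 : (0 <= K)%E.
  by apply: sume_ge0 => S _; exact: sensed_precision_ge0 design S.
have step S : S \in F ->
    ((l * (1 - eps))%:E <= (mu ^+ 2)%:E * sensed_precision A Gamma S +
       (expR l - 1)%:E * p0 S)%E.
  move=> SF; apply: le_trans (observation_bound design mu S l_ge0 (mShat S)).
  rewrite EFinM; apply: lee_wpmul2l; first by rewrite lee_fin.
  set E := observation A Gamma W mu S @^-1` [set u | Shat u = S].
  have mE : measurable E by exact: (measurable_observation design).
  have := err S (fintype.subsetP FC S SF).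
  rewrite (_ : [set w | _] = ~` E)// probability_setC//.
  have -> : P E = (fine (P E))%:E by rewrite fineK// fin_num_measure.
  by rewrite -EFinB !lee_fin; lra.
have T0 : (0 < #|T|)%N by apply/card_gt0P; exists (A 0%N point).
have total : ((#|F|%:R * (l * (1 - eps)))%:E <= (mu ^+ 2)%:E * K + (expR l - 1)%:E)%E.
  rewrite (_ : (#|F|%:R * _)%:E = \sum_(S in F) (l * (1 - eps))%:E)%E; last first.
    by rewrite sumEFin sumr_const mulr_natl.
  apply: le_trans (lee_sum _ step) _; rewrite big_split/=; apply: leeD.
    by rewrite -ge0_sume_distrr// => S _; exact: sensed_precision_ge0 design S.
  rewrite -ge0_sume_distrr// -[leRHS]mule1; apply: lee_wpmul2l.
    by rewrite lee_fin; have := expR_ge1Dx l; lra.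
  by apply: null_recovery_le1 => S; exact: (measurable_drifted design).
have freqK := sum_sensed_precision freq design.
rewrite -/K in freqK.
(* An infinite total would contradict the finite budget, because there is at least one
   coordinate. *)
have [r Kr] : exists r, K = r%:E.
  exists (fine K); rewrite fineK// ge0_fin_numE// ltNge leye_eq; apply/negP => /eqP Koo.
  by move: freqK; rewrite Koo gt0_muley ?lte_fin ?ltr0n// leye_eq.
move: total freqK; rewrite Kr -!EFinM -EFinD !lee_fin => total freqK.
have F0 : 0 < #|F|%:R :> R by rewrite ltr0n (leq_trans _ NF)// -(ltr0n R); lra.
have NF' : N%:R <= #|F|%:R :> R by rewrite ler_nat.
have n0 : 0 < #|T|%:R :> R by rewrite ltr0n.
(* The choice of [l] makes [expR l - 1 = N - 2] at most [#|F|], so after division by [#|F|] the null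
   probabilities cost only the term 1. *)
have main : #|T|%:R * (l * (1 - eps) - 1) <= mu ^+ 2 * (q%:R * m).
  rewrite -(ler_pM2l F0); rewrite natrM in freqK.
  have e1 : #|T|%:R * (#|F|%:R * (l * (1 - eps))) <=
            #|T|%:R * (mu ^+ 2 * r + (expR l - 1)).
    by rewrite ler_pM2l.
  have e2 : mu ^+ 2 * (#|T|%:R * r) <= mu ^+ 2 * (#|F|%:R * q%:R * m).
    by rewrite ler_pM2l// exprn_gt0.
  have e3 : #|T|%:R * (expR l - 1) <= #|T|%:R * #|F|%:R.
    by rewrite ler_pM2l// el; lra.
  lra.
rewrite -[leRHS]ger0_norm ?(ltW mu0)// -sqrtr_sqr ler_wsqrtr//.
have q0' : 0 < q%:R :> R by rewrite ltr0n.
rewrite mulrA mulrAC ler_pdivrMr; last by rewrite !mulr_gt0.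
(* After cancelling [#|T|] this is equivalent to [2 <= l]. *)
have : #|T|%:R * ((1 - 2 * eps) * l) <= #|T|%:R * (2 * (l * (1 - eps) - 1)).
  by rewrite ler_pM2l//; lra.
lra.
Qed.

(** * The lower bounds for the five classes *)

Theorem proposition11 (R : realType) (m mu eps : R)
    (hm : 0 < m) (hmu : 0 < mu) (heps : 0 < eps) :
  (forall n s : nat, (1 <= s)%N ->
     let N := 'C(n, s) in
     1 + Num.sqrt 2 <= (1 - 2 * eps) * ln (N%:R - 1) ->
     recoverable (s_sets n s) m mu eps ->
     Num.sqrt ((1 - 2 * eps) * (n%:R / (2 * s%:R * m)) * ln (N%:R - 1)) <= mu)
  /\
  (forall n s : nat, (1 <= s)%N -> (s %| n)%N ->
     let N := (n %/ s)%N in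
     1 + Num.sqrt 2 <= (1 - 2 * eps) * ln (N%:R - 1) ->
     recoverable (s_intervals n s) m mu eps ->
     Num.sqrt ((1 - 2 * eps) * (n%:R / (2 * s%:R * m)) * ln (N%:R - 1)) <= mu)
  /\
  (forall n s k : nat, (1 <= s)%N -> (1 <= k)%N -> (s %| n)%N ->
     let N := 'C(n %/ s, k) in
     1 + Num.sqrt 2 <= (1 - 2 * eps) * ln (N%:R - 1) ->
     recoverable (disjoint_unions k (s_intervals n s)) m mu eps ->
     Num.sqrt ((1 - 2 * eps) * (n%:R / (2 * k%:R * s%:R * m)) *
               ln (N%:R - 1)) <= mu)
  /\
  (forall p n s k : nat, (1 <= s)%N -> (1 <= k)%N ->
     n = ((p * (p - 1)) %/ 2)%N -> (k * (s + 1) <= p)%N ->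
     let N := 'C(p, k * (s + 1)) in
     1 + Num.sqrt 2 <= (1 - 2 * eps) * ln (N%:R - 1) ->
     recoverable (disjoint_unions k (s_stars p s)) m mu eps ->
     Num.sqrt ((1 - 2 * eps) * (n%:R / (2 * k%:R * s%:R * m)) *
               ln (N%:R - 1)) <= mu)
  /\
  (forall n1 n2 n s r : nat, (1 <= s)%N ->
     n = (n1 * n2)%N -> (r ^ 2)%N = s ->
     let N := ('C(n1, r) * 'C(n2, r))%N in
     1 + Num.sqrt 2 <= (1 - 2 * eps) * ln (N%:R - 1) ->
     recoverable (s_submatrices n1 n2 s) m mu eps ->
     Num.sqrt ((1 - 2 * eps) * (n%:R / (2 * s%:R * m)) * ln (N%:R - 1)) <= mu).
Proof.
split; [|split; [|split; [|split]]].
- move=> n s s0 N hN rec.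
  have freq i : (#|[set S in s_sets n s | i \in S]%SET| * #|'I_n|
                 <= #|s_sets n s| * s)%N by rewrite s_sets_frequency.
  have NF : (N <= #|s_sets n s|)%N by rewrite card_s_sets.
  have := recoverable_lower_bound hm hmu heps s0 (fintype.subxx _) NF freq hN rec.
  by rewrite card_ord.
- move=> n s s0 sn N hN rec.
  have freq i : (#|[set S in block_unions n s 1 | i \in S]%SET| * #|'I_n|
    <= #|block_unions n s 1| * s)%N by rewrite (block_unions_frequency s0 sn) mul1n.
  have NF : (N <= #|block_unions n s 1|)%N by rewrite (card_block_unions s0 sn) bin1.
  (* The family consists of the [n %/ s] blocks, seen as unions of one block. *)
  have FC := fintype.subset_trans (block_unions_sub s0 sn 1) (disjoint_unions1_sub _).
  have := recoverable_lower_bound hm hmu heps s0 FC NF freq hN rec.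
  by rewrite card_ord.
- move=> n s k s0 k0 sn N hN rec.
  have freq i : (#|[set S in block_unions n s k | i \in S]%SET| * #|'I_n|
    <= #|block_unions n s k| * (k * s))%N by rewrite (block_unions_frequency s0 sn).
  have NF : (N <= #|block_unions n s k|)%N by rewrite (card_block_unions s0 sn).
  have ks0 : (0 < k * s)%N by rewrite muln_gt0 k0.
  have FC := block_unions_sub s0 sn k.
  have := recoverable_lower_bound hm hmu heps ks0 FC NF freq hN rec.
  by rewrite card_ord natrM (mulrA 2).
- move=> p n s k s0 k0 -> kp N hN rec.
  set F := disjoint_unions k (s_stars p s) in rec.
  have freq e : (#|[set S in F | e \in S]%SET| * #|{: edge p}|
    <= #|F| * (k * s))%N by rewrite star_unions_frequency.
  (* Here the family is the whole class, and [N] counts only the vertex sets that its members can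
     span. *)
  have NF : (N <= #|F|)%N by exact: card_star_unions.
  have ks0 : (0 < k * s)%N by rewrite muln_gt0 k0.
  have := recoverable_lower_bound hm hmu heps ks0 (fintype.subxx _) NF freq hN rec.
  by rewrite card_edge natrM (mulrA 2).
- move=> n1 n2 n s r s0 -> rs N hN rec.
  have r0 : (0 < r)%N by move: s0; rewrite -rs expn_gt0 orbF.
  have freq x : (#|[set S in s_submatrices n1 n2 s | x \in S]%SET| *
    #|{: 'I_n1 * 'I_n2}| <= #|s_submatrices n1 n2 s| * s)%N
    by rewrite submatrices_frequency.
  have NF : (N <= #|s_submatrices n1 n2 s|)%N by rewrite -rs; exact: card_submatrices.
  have := recoverable_lower_bound hm hmu heps s0 (fintype.subxx _) NF freq hN rec.
  by rewrite card_prod !card_ord.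
Qed.
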